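(* Let $X, Y \in \mathbb{C}^{n\times m}$, let $\tilde y_j$ denote the $j$-th row of $Y$, and let $X_{j:n,:}$ denote the submatrix of $X$ consisting of rows $j,\dots,n$. The minimum-norm solution of the upper triangular Procrustes problem $$\min\{\|Y - AX\|_F : A\in\mathbb{C}^{n\times n}\text{ upper triangular}\}$$ is the upper triangular matrix $A$ whose rows satisfy $$A_{j,j:n} = \tilde y_j\, X_{j:n,:}^{\dagger}, \qquad 1\le j\le n,$$ where $A_{j,j:n}$ is the row vector of entries $A_{j,j},\dots,A_{j,n}$.
   Context: $\|\cdot\|_F$ is the Frobenius norm, $\dagger$ is the Moore--Penrose pseudoinverse, and ''minimum-norm solution'' means the minimizer whose rows (equivalently, which itself in Frobenius norm) have the smallest Euclidean norm among all minimizers. *)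

(* Defs.v *)
From HB Require Import structures.
From mathcomp Require Import all_boot all_order all_algebra.
From mathcomp Require Import spectral complex reals.

Set Implicit Arguments.
Unset Strict Implicit.
Unset Printing Implicit Defensive.

Import Order.TTheory GRing.Theory Num.Theory.

Local Open Scope ring_scope.
Local Open Scope sesquilinear_scope.

Section Frobenius.
Variable C : numClosedFieldType.

(* The value lies in C, but it is a nonnegative real, and the order of C
   restricts to the usual order on the reals. On row vectors this is the
   Euclidean norm. *)
Definition frobnorm p q (M : 'M[C]_(p, q)) : C :=
  sqrtC (\sum_(i < p) \sum_(j < q) `|M i j| ^+ 2).

End Frobenius.

Section MoorePenrose.
Variable C : numClosedFieldType.

(* The four Penrose equations; M^t* is the conjugate transpose of M. *)
Definition is_mpinv p q (M : 'M[C]_(p, q)) (P : 'M[C]_(q, p)) : bool :=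
  [&& M *m P *m M == M, P *m M *m P == P,
      (M *m P)^t* == M *m P & (P *m M)^t* == P *m M].

Lemma trmxC_mul p q r (M : 'M[C]_(p, q)) (N : 'M[C]_(q, r)) :
  (M *m N)^t* = N^t* *m M^t*.
Proof. by rewrite trmx_mul map_mxM. Qed.

Lemma gram_unitmx r q (G : 'M[C]_(r, q)) :
  row_free G -> G *m G^t* \in unitmx.
Proof.
move=> freeG; rewrite -row_free_unit; apply: inj_row_free => v vGG0.
apply: (row_free_inj freeG); rewrite mul0mx; apply/eqP.
apply: contraTT isT => /dotmx_is_dotmx; rewrite dotmxE trmxC_mul mulmxA.
by rewrite -(mulmxA v) vGG0 mul0mx mxE ltxx.
Qed.

Lemma trmxC_inv r (U : 'M[C]_r) : (invmx U)^t* = invmx (U^t*).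
Proof. by rewrite trmx_inv map_invmx. Qed.

Lemma mpinv_exists p q (M : 'M[C]_(p, q)) : exists P, is_mpinv M P.
Proof.
have [r [F [G [defM fullF freeG]]]] : exists r (F : 'M[C]_(p, r))
    (G : 'M[C]_(r, q)), [/\ M = F *m G, row_full F & row_free G].
  exists (\rank M), (col_base M), (row_base M).
  by rewrite mulmx_base col_base_full row_base_free.
have uG : G *m G^t* \in unitmx by apply: gram_unitmx.
have uF : F^t* *m F \in unitmx.
  rewrite -{2}(trmxCK F); apply: gram_unitmx.
  by rewrite /row_free mxrank_map mxrank_tr.
set V := invmx (G *m G^t*); set U := invmx (F^t* *m F).
have GV : G *m G^t* *m V = 1%:M by rewrite mulmxV.
have UF : U *m (F^t* *m F) = 1%:M by rewrite mulVmx.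
have sV : V^t* = V by rewrite trmxC_inv trmxC_mul trmxCK.
have sU : U^t* = U by rewrite trmxC_inv trmxC_mul trmxCK.
pose P := G^t* *m V *m (U *m F^t*).
have MP : M *m P = F *m (U *m F^t*).
  by rewrite defM /P -(mulmxA F) !(mulmxA G) GV mul1mx.
have PM : P *m M = G^t* *m V *m G.
  rewrite defM /P -!mulmxA; congr (_ *m (_ *m _)).
  by rewrite (mulmxA _ F) mulmxA UF mul1mx.
exists P; apply/and4P; split; apply/eqP.
- by rewrite MP defM !mulmxA -[F *m U *m _ *m _]mulmxA -(mulmxA F) UF mulmx1.
- rewrite PM /P -!(mulmxA (G^t* *m V)) !mulmxA -(mulmxA _ G).
  by rewrite -(mulmxA _ (G *m _)) GV mulmx1.
- by rewrite MP !trmxC_mul trmxCK sU mulmxA.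
- by rewrite PM !trmxC_mul trmxCK sV mulmxA.
Qed.

(* The Moore-Penrose inverse; it differs from the library's pinvmx, which is
   an arbitrary partial inverse. *)
Definition mpinv p q (M : 'M[C]_(p, q)) : 'M[C]_(q, p) :=
  xchoose (mpinv_exists M).

Lemma mpinvP p q (M : 'M[C]_(p, q)) : is_mpinv M (mpinv M).
Proof. exact: xchooseP. Qed.

Lemma mpinv_unique p q (M : 'M[C]_(p, q)) (P : 'M[C]_(q, p)) :
  is_mpinv M P -> P = mpinv M.
Proof.
have /and4P[/eqP q1 /eqP q2 /eqP q3 /eqP q4] := mpinvP M.
case/and4P=> /eqP p1 /eqP p2 /eqP p3 /eqP p4; set Q := mpinv M in q1 q2 q3 q4 *.
have MPQ : M *m P = M *m Q.
  by rewrite -p3 -{1}q1 -(mulmxA (M *m Q)) trmxC_mul p3 q3 mulmxA p1.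
have PQM : P *m M = Q *m M.
  by rewrite -p4 -{1}q1 -(mulmxA M) mulmxA trmxC_mul p4 q4 -mulmxA (mulmxA M) p1.
by rewrite -p2 -mulmxA MPQ mulmxA PQM q2.
Qed.

End MoorePenrose.

(* The indices j, j+1, ..., n-1, where j is counted from 0. *)
Definition tail_ord n (j : 'I_n) (k : 'I_(n - j)) : 'I_n :=
  cast_ord (subnKC (ltnW (ltn_ord j))) (rshift j k).

Section Procrustes.
Variable C : numClosedFieldType.

(* is_trig_mx means lower triangular. *)
Definition is_upper_trig_mx n (A : 'M[C]_n) : bool := is_trig_mx A^T.

Definition tail_rows n m (X : 'M[C]_(n, m)) (j : 'I_n) : 'M[C]_(n - j, m) :=
  rowsub (@tail_ord n j) X.

Definition tail_of_row n (A : 'M[C]_n) (j : 'I_n) : 'rV[C]_(n - j) :=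
  colsub (@tail_ord n j) (row j A).

Variables (n m : nat) (X Y : 'M[C]_(n, m)).

Definition procrustes_minimizer (A : 'M[C]_n) : Prop :=
  is_upper_trig_mx A /\
  forall B : 'M[C]_n, is_upper_trig_mx B ->
    frobnorm (Y - A *m X) <= frobnorm (Y - B *m X).

Definition min_norm_solution (A : 'M[C]_n) : Prop :=
  procrustes_minimizer A /\
  forall B : 'M[C]_n, procrustes_minimizer B -> frobnorm A <= frobnorm B.

Definition rowwise_min_norm_solution (A : 'M[C]_n) : Prop :=
  procrustes_minimizer A /\
  forall B : 'M[C]_n, procrustes_minimizer B ->
    forall j : 'I_n, frobnorm (row j A) <= frobnorm (row j B).

End Procrustes.

(* Main.v *)
(** For upper triangular [A], row [j] of [Y - A X] only involves the entries
    [A j k] with [j <= k], so the problem splits into independent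
    least-squares problems [min |y_j - a X_(j:n)|], one for each row.  For
    each of these, [a0 = y_j X_(j:n)^+] satisfies two Pythagorean identities:
    [|y - a X|^2 = |y - a0 X|^2 + |(a0 - a) X|^2] for all [a], and
    [|a|^2 = |a0|^2 + |a - a0|^2] for all [a] with [a X = a0 X].  The first
    characterizes the minimizers, the second singles out [a0] among them. *)
Require Import Defs.
From mathcomp Require Import all_boot all_order all_algebra.
From mathcomp Require Import complex reals.
From mathcomp Require Import spectral.

Set Implicit Arguments.
Unset Strict Implicit.
Unset Printing Implicit Defensive.

Import Order.TTheory GRing.Theory Num.Theory.

Local Open Scope ring_scope.
Local Open Scope complex_scope.

(** * Squared Frobenius norm and orthogonality *)

Section FrobeniusSquare.
Local Open Scope sesquilinear_scope.
Variable C : numClosedFieldType.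

Definition frobsq p q (M : 'M[C]_(p, q)) : C :=
  \sum_(i < p) \sum_(j < q) `|M i j| ^+ 2.

Lemma frobsq_ge0 p q (M : 'M[C]_(p, q)) : 0 <= frobsq M.
Proof. by apply: sumr_ge0 => i _; apply: sumr_ge0 => j _; rewrite exprn_ge0. Qed.

Lemma ler_frobnorm p q p' q' (M : 'M[C]_(p, q)) (N : 'M[C]_(p', q')) :
  (frobnorm M <= frobnorm N) = (frobsq M <= frobsq N).
Proof. by rewrite /frobnorm ler_sqrtC // qualifE /= frobsq_ge0. Qed.

Lemma frobsq_eq0 p q (M : 'M[C]_(p, q)) : frobsq M = 0 -> M = 0.
Proof.
have ge0 i : 0 <= \sum_(j < q) `|M i j| ^+ 2.
  by apply: sumr_ge0 => j _; rewrite exprn_ge0.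
move=> /eqP; rewrite psumr_eq0 // => /allP /= M0; apply/matrixP => i j.
have /eqP/eqP := M0 i (mem_index_enum i).
rewrite psumr_eq0 => [/allP/(_ j (mem_index_enum j))|k _]; last exact: exprn_ge0.
by rewrite expf_eq0 /= normr_eq0 mxE => /eqP.
Qed.

Lemma frobsqN p q (M : 'M[C]_(p, q)) : frobsq (- M) = frobsq M.
Proof. by apply: eq_bigr => i _; apply: eq_bigr => j _; rewrite mxE normrN. Qed.

Lemma frobsq_row p q (M : 'M[C]_(p, q)) :
  frobsq M = \sum_(i < p) frobsq (row i M).
Proof.
apply: eq_bigr => i _; rewrite /frobsq big_ord1.
by apply: eq_bigr => j _; rewrite mxE.
Qed.

Lemma frobsq_mxtrace p q (M : 'M[C]_(p, q)) : frobsq M = \tr (M *m M^t*).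
Proof.
apply: eq_bigr => i _; rewrite mxE; apply: eq_bigr => j _.
by rewrite normCK !mxE.
Qed.

Lemma frobsq0 p q : frobsq (0 : 'M[C]_(p, q)) = 0.
Proof. by rewrite frobsq_mxtrace mul0mx mxtrace0. Qed.

(** In the trace form of [frobsq] the cross terms are [M *m N^t*] and its conjugate transpose, so
    both vanish. *)
Lemma frobsq_pythagoras p q (M N : 'M[C]_(p, q)) :
  M *m N^t* = 0 -> frobsq (M + N) = frobsq M + frobsq N.
Proof.
move=> MN0; have NM0 : N *m M^t* = 0.
  by rewrite -[N *m _]trmxCK trmxC_mul trmxCK MN0 trmx0 map_mx0.
rewrite !frobsq_mxtrace linearD /= map_mxD mulmxDl !mulmxDr MN0 NM0.
by rewrite addr0 add0r linearD.
Qed.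

Lemma frobsq_mul_coisometry p q r (M : 'M[C]_(p, q)) (E : 'M[C]_(q, r)) :
  E *m E^t* = 1%:M -> frobsq (M *m E) = frobsq M.
Proof.
by move=> EE1; rewrite !frobsq_mxtrace trmxC_mul mulmxA -(mulmxA M) EE1 mulmx1.
Qed.

End FrobeniusSquare.

(** * Least squares through the pseudoinverse *)

Section LeastSquares.
Local Open Scope sesquilinear_scope.
Variables (C : numClosedFieldType) (p q r : nat).
Variables (Z : 'M[C]_(q, r)) (Y : 'M[C]_(p, r)).

(** With [P = mpinv Z], the product [P *m Z] is Hermitian and fixes [Z^t*], so the residual of
    [Y *m P] is orthogonal to the row space of [Z], which contains the rows of the other summand. *)
Lemma frobsq_residual (B : 'M[C]_(p, q)) :
  frobsq (Y - B *m Z) =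
  frobsq (Y - Y *m mpinv Z *m Z) + frobsq ((Y *m mpinv Z - B) *m Z).
Proof.
have /and4P[/eqP ZPZ _ _ /eqP PZ] := mpinvP Z.
rewrite -frobsq_pythagoras; first by rewrite mulmxBl addrA subrK.
have PZZ : mpinv Z *m Z *m Z^t* = Z^t* by rewrite -PZ -trmxC_mul mulmxA ZPZ.
have resZ : (Y - Y *m mpinv Z *m Z) *m Z^t* = 0.
  by rewrite mulmxBl -!mulmxA (mulmxA (mpinv Z)) PZZ subrr.
by rewrite trmxC_mul mulmxA resZ mul0mx.
Qed.

(** With [P = mpinv Z], the Hermitian [Z *m P] fixes [P^t*]. Hence whatever [Z] annihilates on the
    right is also annihilated by [P^t*], and so is orthogonal to [Y *m P]. *)
Lemma frobsq_min_norm (B : 'M[C]_(p, q)) :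
  (Y *m mpinv Z - B) *m Z = 0 ->
  frobsq B = frobsq (Y *m mpinv Z) + frobsq (Y *m mpinv Z - B).
Proof.
have /and4P[_ /eqP PZP /eqP ZP _] := mpinvP Z.
move=> BZ0; rewrite -[frobsq (_ - B)]frobsqN addrC -frobsq_pythagoras.
  by rewrite opprB subrK.
have PE : (mpinv Z)^t* = Z *m mpinv Z *m (mpinv Z)^t*.
  by rewrite -[in RHS]ZP -trmxC_mul mulmxA PZP.
by rewrite mulNmx trmxC_mul PE !mulmxA BZ0 !mul0mx oppr0.
Qed.

End LeastSquares.

(** * Row tails of upper triangular matrices *)

Section Tails.
Local Open Scope sesquilinear_scope.
Variables (C : numClosedFieldType) (n : nat).
Implicit Types (A B : 'M[C]_n) (j : 'I_n).

Lemma tail_ord_inj j : injective (@tail_ord n j).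
Proof. by move=> k l /cast_ord_inj/rshift_inj. Qed.

Lemma leq_tail_ord j k : (j <= tail_ord (j := j) k)%N.
Proof. exact: leq_addr. Qed.

Lemma tail_ord_surj j (k : 'I_n) :
  (j <= k)%N -> exists l, k = tail_ord (j := j) l.
Proof.
move=> le_jk; have lt_k : (k - j < n - j)%N.
  by rewrite ltn_sub2r ?(leq_ltn_trans le_jk).
by exists (Ordinal lt_k); apply: val_inj; rewrite /= subnKC.
Qed.

(* [x *m tail_embed j] is the row vector [x] preceded by [j] zeros. *)
Definition tail_embed j : 'M[C]_(n - j, n) := tail_rows 1%:M j.

Lemma tail_embedE j k l : tail_embed j k l = (tail_ord k == l)%:R.
Proof. by rewrite !mxE. Qed.

(** The rows of [tail_embed j] are distinct standard basis vectors, since [tail_ord] is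
    injective. *)
Lemma tail_embed_coisometry j : tail_embed j *m (tail_embed j)^t* = 1%:M.
Proof.
apply/matrixP => k l; rewrite mxE (bigD1 (tail_ord k)) //= big1 => [|i].
  rewrite addr0 tail_embedE eqxx mul1r mxE mxE tail_embedE mxE conjC_nat.
  by rewrite (inj_eq (@tail_ord_inj j)) eq_sym.
by rewrite tail_embedE eq_sym => /negPf->; rewrite mul0r.
Qed.

Lemma mul_tail_embed m (X : 'M[C]_(n, m)) j :
  tail_embed j *m X = tail_rows X j.
Proof. by rewrite /tail_embed /tail_rows mul_rowsub_mx mul1mx. Qed.

Lemma mul_embed_tail_ord j (x : 'rV[C]_(n - j)) k :
  (x *m tail_embed j) 0 (tail_ord k) = x 0 k.
Proof.
rewrite mxE (bigD1 k) //= big1 => [|i /negPf ik]; rewrite tail_embedE.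
  by rewrite eqxx mulr1 addr0.
by rewrite (inj_eq (@tail_ord_inj j)) ik mulr0.
Qed.

Lemma mul_embed_lt j (x : 'rV[C]_(n - j)) (k : 'I_n) :
  (k < j)%N -> (x *m tail_embed j) 0 k = 0.
Proof.
move=> lt_kj; rewrite mxE big1 // => i _; rewrite tail_embedE.
case: eqP => [ik|]; rewrite ?mulr0 //.
by move: lt_kj; rewrite -ik ltnNge leq_tail_ord.
Qed.

Lemma row_upper_trig A j :
  is_upper_trig_mx A -> row j A = tail_of_row A j *m tail_embed j.
Proof.
move=> /is_trig_mxP trigA; apply/rowP => k.
have [lt_kj|/tail_ord_surj[l ->]] := ltnP k j.
  by rewrite mul_embed_lt // mxE; have := trigA k j lt_kj; rewrite mxE.
by rewrite mul_embed_tail_ord !mxE.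
Qed.

Lemma is_upper_trig_mxB A B :
  is_upper_trig_mx A -> is_upper_trig_mx B -> is_upper_trig_mx (A - B).
Proof.
move=> /is_trig_mxP trigA /is_trig_mxP trigB; apply/is_trig_mxP => i j lt_ij.
by have := trigA i j lt_ij; have := trigB i j lt_ij; rewrite !mxE => -> ->; rewrite subr0.
Qed.

Lemma tail_of_rowB A B j :
  tail_of_row (A - B) j = tail_of_row A j - tail_of_row B j.
Proof. by apply/rowP => k; rewrite !mxE. Qed.

Lemma row_upper_trig_mul m (X : 'M[C]_(n, m)) A j :
  is_upper_trig_mx A -> row j (A *m X) = tail_of_row A j *m tail_rows X j.
Proof. by move=> trigA; rewrite row_mul row_upper_trig // -mulmxA mul_tail_embed. Qed.

Lemma frobsq_row_upper_trig A j :
  is_upper_trig_mx A -> frobsq (row j A) = frobsq (tail_of_row A j).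
Proof.
by move=> trigA; rewrite row_upper_trig // frobsq_mul_coisometry ?tail_embed_coisometry.
Qed.

(** The tails can be prescribed independently: pad each with zeros on the left and stack the
    results. This is what decouples the rows. *)
Lemma upper_trig_of_tails (x : forall j, 'rV[C]_(n - j)) :
  exists2 A, is_upper_trig_mx A & forall j, tail_of_row A j = x j.
Proof.
exists (\matrix_j (x j *m tail_embed j)).
  by apply/is_trig_mxP => i j lt_ij; rewrite 2![LHS]mxE mul_embed_lt.
by move=> j; apply/rowP => k; rewrite 3![LHS]mxE mul_embed_tail_ord.
Qed.

End Tails.

(** * Minimizers of the triangular problem *)

Section Procrustes.
Variables (C : numClosedFieldType) (n m : nat) (X Y : 'M[C]_(n, m)).
Implicit Types A B : 'M[C]_n.

Definition procrustes_formula A : Prop :=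
  is_upper_trig_mx A /\
  forall j : 'I_n, tail_of_row A j = row j Y *m mpinv (tail_rows X j).

Lemma procrustes_formula_exists : exists A, procrustes_formula A.
Proof.
have [A trigA tailA] :=
  upper_trig_of_tails (fun j => row j Y *m mpinv (tail_rows X j)).
by exists A.
Qed.

Lemma procrustes_formula_unique A B :
  procrustes_formula A -> procrustes_formula B -> A = B.
Proof.
move=> [trigA tailA] [trigB tailB]; apply/row_matrixP => j.
by rewrite !row_upper_trig // tailA tailB.
Qed.

Variable A0 : 'M[C]_n.
Hypothesis A0P : procrustes_formula A0.

(** Sum over [j] of [frobsq_residual] with [Z = tail_rows X j]. *)
Lemma procrustes_residual B : is_upper_trig_mx B ->
  frobsq (Y - B *m X) = frobsq (Y - A0 *m X) + frobsq ((A0 - B) *m X).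
Proof.
have [trigA tailA] := A0P; move=> trigB.
rewrite !frobsq_row -big_split; apply: eq_bigr => j _ /=.
rewrite [row j ((A0 - B) *m X)]row_upper_trig_mul ?is_upper_trig_mxB //.
by rewrite !linearB /= !row_upper_trig_mul // tail_of_rowB tailA frobsq_residual.
Qed.

Lemma procrustes_minimizerP B :
  procrustes_minimizer X Y B <-> is_upper_trig_mx B /\ (A0 - B) *m X = 0.
Proof.
have [trigA _] := A0P; split=> [[trigB minB]|[trigB BX0]]; split=> //.
  apply: frobsq_eq0; apply/eqP; rewrite eq_le frobsq_ge0 andbT.
  (* Comparing [B] with the competitor [A0] leaves no room for the extra term. *)
  by have := minB _ trigA; rewrite ler_frobnorm procrustes_residual // gerDl.
move=> D trigD; rewrite ler_frobnorm (procrustes_residual trigB).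
by rewrite (procrustes_residual trigD) lerD2l BX0 frobsq0 frobsq_ge0.
Qed.

Lemma procrustes_minimizer_formula : procrustes_minimizer X Y A0.
Proof.
by apply/procrustes_minimizerP; have [trigA _] := A0P; rewrite subrr mul0mx.
Qed.

(** Row [j] of [(A0 - B) *m X = 0] says that the difference of the tails annihilates
    [tail_rows X j], as [frobsq_min_norm] requires. *)
Lemma procrustes_row_min_norm B j : procrustes_minimizer X Y B ->
  frobsq (row j B) = frobsq (row j A0) + frobsq (row j (A0 - B)).
Proof.
have [trigA tailA] := A0P => /procrustes_minimizerP[trigB BX0].
have trigAB := is_upper_trig_mxB trigA trigB.
rewrite !frobsq_row_upper_trig // tail_of_rowB tailA -frobsq_min_norm //.
by rewrite -tailA -tail_of_rowB -row_upper_trig_mul // BX0 row0.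
Qed.

Lemma procrustes_min_norm B : procrustes_minimizer X Y B ->
  frobsq B = frobsq A0 + frobsq (A0 - B).
Proof.
move=> minB; rewrite !frobsq_row -big_split; apply: eq_bigr => j _.
exact: procrustes_row_min_norm.
Qed.

Lemma min_norm_solutionP B : min_norm_solution X Y B <-> B = A0.
Proof.
have minA := procrustes_minimizer_formula; split=> [[minB leB]|->]; last first.
  by split=> // D minD; rewrite ler_frobnorm (procrustes_min_norm minD) lerDl frobsq_ge0.
apply/eqP; rewrite eq_sym -subr_eq0; apply/eqP/frobsq_eq0/eqP.
rewrite eq_le frobsq_ge0 andbT.
(* Minimality of [B] against [A0] forces [frobsq (A0 - B) <= 0]. *)
by have := leB _ minA; rewrite ler_frobnorm (procrustes_min_norm minB) gerDl.
Qed.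

Lemma rowwise_min_norm_solutionP B :
  rowwise_min_norm_solution X Y B <-> B = A0.
Proof.
have minA := procrustes_minimizer_formula; split=> [[minB leB]|->]; last first.
  split=> // D minD j.
  by rewrite ler_frobnorm (procrustes_row_min_norm j minD) lerDl frobsq_ge0.
(* Summing the squared row inequalities turns rowwise minimality into Frobenius minimality, whose
   solution is already known. *)
apply/min_norm_solutionP; split=> // D minD; rewrite ler_frobnorm !frobsq_row.
by apply: ler_sum => j _; rewrite -ler_frobnorm leB.
Qed.

End Procrustes.

Theorem mainTheorem4 (R : realType) (n m : nat) (X Y : 'M[R[i]]_(n, m)) :
  [/\ exists! A : 'M[R[i]]_n, min_norm_solution X Y A,
      forall A : 'M[R[i]]_n,
        min_norm_solution X Y A <-> rowwise_min_norm_solution X Y A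
    & forall A : 'M[R[i]]_n,
        min_norm_solution X Y A <->
        is_upper_trig_mx A /\
        forall j : 'I_n,
          tail_of_row A j = row j Y *m mpinv (tail_rows X j)].
Proof.
have [A0 A0P] := procrustes_formula_exists X Y.
have minP := min_norm_solutionP A0P; split=> [|A|A].
- by exists A0; split=> [|A /minP->//]; apply/minP.
- split=> [/minP|/(rowwise_min_norm_solutionP A0P)] ->.
    exact/(rowwise_min_norm_solutionP A0P).
  exact/minP.
- split=> [/minP-> //|formulaA]; apply/minP.
  exact: procrustes_formula_unique formulaA A0P.
Qed.
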